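(* As formal power series in $q$ (equivalently, for all complex $q$ with $|q|<1$), $$\sum_{n,r\ge 0} \frac{q^{2n^2+3r^2+4nr}}{(-q;q)_{2n+2r}\,(q;q^2)_r\,(q;q)_r\,(q^2;q^2)_n} = \frac{(q^{14},q^{16},q^{30};q^{30})_\infty}{(q^2;q^2)_\infty}.$$
   Context: Notation: $(a;q)_m=\prod_{j=0}^{m-1}(1-aq^j)$ for integers $m\ge 0$, $(a;q)_\infty=\prod_{j=0}^{\infty}(1-aq^j)$, and $(a_1,\dots,a_s;q)_\infty=(a_1;q)_\infty\cdots(a_s;q)_\infty$; the base may be replaced by any power of $q$ (e.g. $(a;q^2)_m=\prod_{j=0}^{m-1}(1-aq^{2j})$). *)

(* Defs.v *)
From HB Require Import structures.
From mathcomp Require Import all_boot all_order all_algebra.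
From mathcomp Require Import finmap boolp classical_sets.

Set Implicit Arguments.
Unset Strict Implicit.
Unset Printing Implicit Defensive.

Import GRing.Theory.
Local Open Scope ring_scope.

(* Formal power series over R, given by their coefficient sequences.  The
   record keeps the Cauchy product apart from the pointwise ring structure that
   plain functions nat -> R may carry. *)
Record fps (R : Type) := Fps { coefs : nat -> R }.

Lemma fpsP (R : Type) (f g : fps R) :
  (forall k, coefs f k = coefs g k) <-> f = g.
Proof.
split=> [fg|-> //]; case: f g fg => [f] [g] /= fg.
by congr Fps; apply: funext.
Qed.

HB.instance Definition _ (R : Type) := gen_eqMixin (fps R).
HB.instance Definition _ (R : Type) := gen_choiceMixin (fps R).

Definition fps_zero (R : zmodType) : fps R := Fps (fun=> 0).
Definition fps_opp (R : zmodType) (f : fps R) := Fps (fun k => - coefs f k).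
Definition fps_add (R : zmodType) (f g : fps R) :=
  Fps (fun k => coefs f k + coefs g k).

Lemma fps_addA (R : zmodType) : associative (@fps_add R).
Proof. by move=> f g h; apply/fpsP => k /=; rewrite addrA. Qed.
Lemma fps_addC (R : zmodType) : commutative (@fps_add R).
Proof. by move=> f g; apply/fpsP => k /=; rewrite addrC. Qed.
Lemma fps_add0 (R : zmodType) : left_id (@fps_zero R) (@fps_add R).
Proof. by move=> f; apply/fpsP => k /=; rewrite add0r. Qed.
Lemma fps_addN (R : zmodType) :
  left_inverse (@fps_zero R) (@fps_opp R) (@fps_add R).
Proof. by move=> f; apply/fpsP => k /=; rewrite addNr. Qed.

HB.instance Definition _ (R : zmodType) :=
  GRing.isZmodule.Build (fps R)
    (@fps_addA R) (@fps_addC R) (@fps_add0 R) (@fps_addN R).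

Definition fps_one (R : comNzRingType) : fps R := Fps (fun k => (k == 0%N)%:R).
Definition fps_mul (R : comNzRingType) (f g : fps R) :=
  Fps (fun k => \sum_(i < k.+1) coefs f i * coefs g (k - i)).

Definition fps_trunc (R : comNzRingType) (n : nat) (f : fps R) : {poly R} :=
  \poly_(i < n) coefs f i.

Lemma coef_fps_mul (R : comNzRingType) (f g : fps R) n k : (k < n)%N ->
  coefs (fps_mul f g) k = (fps_trunc n f * fps_trunc n g)`_k.
Proof.
move=> kn; rewrite coefM; apply: eq_bigr => i _; rewrite !coef_poly.
by rewrite (leq_ltn_trans _ kn) ?leq_ord // (leq_ltn_trans _ kn) ?leq_subr.
Qed.

Lemma fps_mulC (R : comNzRingType) : commutative (@fps_mul R).
Proof.
by move=> f g; apply/fpsP => k; rewrite !(@coef_fps_mul _ _ _ k.+1) // mulrC.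
Qed.

Lemma fps_mulA (R : comNzRingType) : associative (@fps_mul R).
Proof.
move=> f g h; apply/fpsP => k; pose t := @fps_trunc R k.+1.
have tM (u v : fps R) i : (i < k.+1)%N ->
    (t (fps_mul u v))`_i = (t u * t v)`_i.
  by move=> ik; rewrite coef_poly ik; apply: coef_fps_mul.
rewrite !(@coef_fps_mul _ _ _ k.+1) // -/t.
transitivity (t f * (t g * t h))`_k.
  rewrite !coefM; apply: eq_bigr => i _; congr (_ * _).
  by apply: tM; rewrite ltnS leq_subr.
rewrite mulrA !coefM; apply: eq_bigr => i _; congr (_ * _).
by apply/esym/tM.
Qed.

Lemma fps_mul1 (R : comNzRingType) : left_id (@fps_one R) (@fps_mul R).
Proof.
move=> f; apply/fpsP => k /=; rewrite big_ord_recl /= mul1r subn0.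
by rewrite big1 ?addr0 // => i _; rewrite mul0r.
Qed.

Lemma fps_mulDl (R : comNzRingType) :
  left_distributive (@fps_mul R) (@fps_add R).
Proof.
move=> f g h; apply/fpsP => k /=; rewrite -big_split /=.
by apply: eq_bigr => i _; rewrite mulrDl.
Qed.

Lemma fps_one_neq0 (R : comNzRingType) : fps_one R != 0.
Proof.
by apply/eqP => /fpsP/(_ 0%N) /= /eqP; rewrite oner_eq0.
Qed.

HB.instance Definition _ (R : comNzRingType) :=
  GRing.Zmodule_isComNzRing.Build (fps R)
    (@fps_mulA R) (@fps_mulC R) (@fps_mul1 R) (@fps_mulDl R) (@fps_one_neq0 R).

Lemma coefs0 (R : zmodType) k : coefs (0 : fps R) k = 0.
Proof. by []. Qed.
Lemma coefsD (R : zmodType) (f g : fps R) k :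
  coefs (f + g) k = coefs f k + coefs g k.
Proof. by []. Qed.
Lemma coefsN (R : zmodType) (f : fps R) k : coefs (- f) k = - coefs f k.
Proof. by []. Qed.
Lemma coefs1 (R : comNzRingType) k : coefs (1 : fps R) k = (k == 0%N)%:R.
Proof. by []. Qed.
Lemma coefsM (R : comNzRingType) (f g : fps R) k :
  coefs (f * g) k = \sum_(i < k.+1) coefs f i * coefs g (k - i).
Proof. by []. Qed.

(* The first n coefficients g_0, ..., g_(n-1) of 1 / f, by the recursion
   f_0 * g_k = [k = 0] - \sum_(i < k) g_i * f_(k - i). *)
Fixpoint fps_inv_seq (R : comUnitRingType) (f : fps R) (n : nat) : seq R :=
  if n is k.+1 then
    let s := fps_inv_seq f k in
    rcons s ((coefs f 0)^-1 *
             ((k == 0%N)%:R - \sum_(i < k) s`_i * coefs f (k - i)))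
  else [::].

Definition fps_unit (R : comUnitRingType) : pred (fps R) :=
  fun f => coefs f 0 \is a GRing.unit.

(* Elements that are not units are fixed by inversion, as the unit ring
   interface requires. *)
Definition fps_inv (R : comUnitRingType) (f : fps R) : fps R :=
  if fps_unit f then Fps (fun k => (fps_inv_seq f k.+1)`_k) else f.

Lemma size_fps_inv_seq (R : comUnitRingType) (f : fps R) n :
  size (fps_inv_seq f n) = n.
Proof. by elim: n => //= n IHn; rewrite size_rcons IHn. Qed.

Lemma nth_fps_inv_seq (R : comUnitRingType) (f : fps R) n k : (k < n)%N ->
  (fps_inv_seq f n)`_k = (fps_inv_seq f k.+1)`_k.
Proof.
elim: n => // n IHn; rewrite ltnS leq_eqVlt => /orP[/eqP-> //|kn].
by rewrite -IHn //= nth_rcons size_fps_inv_seq kn.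
Qed.

Lemma fps_mulV (R : comUnitRingType) :
  {in @fps_unit R, left_inverse 1 (@fps_inv R) *%R}.
Proof.
move=> f fu; have fU : coefs f 0 \is a GRing.unit by [].
apply/fpsP => k.
rewrite coefsM /fps_inv [fps_unit f]fu big_ord_recr subnn.
under eq_bigr => i _ do
  rewrite [coefs (Fps _) _]/= -[rcons _ _]/(fps_inv_seq f i.+1)
          -(@nth_fps_inv_seq _ f k) //.
rewrite /= nth_rcons size_fps_inv_seq ltnn eqxx [X in _ + X]mulrC mulrA.
by rewrite divrr // mul1r addrC subrK.
Qed.

Lemma fps_unitPl (R : comUnitRingType) (f g : fps R) :
  g * f = 1 -> fps_unit f.
Proof.
move=> /fpsP/(_ 0%N); rewrite coefsM big_ord1 subnn coefs1 eqxx => gf1.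
by apply/unitrPr; exists (coefs g 0); rewrite mulrC.
Qed.

Lemma fps_inv_out (R : comUnitRingType) :
  {in [predC @fps_unit R], @fps_inv R =1 id}.
Proof. by move=> f /negbTE fU; rewrite /fps_inv [fps_unit f]fU. Qed.

HB.instance Definition _ (R : comUnitRingType) :=
  GRing.ComNzRing_hasMulInverse.Build (fps R)
    (@fps_mulV R) (@fps_unitPl R) (@fps_inv_out R).

Definition fpsX (R : comNzRingType) : fps R := Fps (fun k => (k == 1%N)%:R).

(* Convergence of a sequence of formal power series: every coefficient is
   eventually constant. *)
Definition fps_cvg (R : Type) (u : nat -> fps R) (s : fps R) : Prop :=
  forall k, exists N0, forall N, (N0 <= N)%N -> coefs (u N) k = coefs s k.

(* The limit of u, with value 0 if u does not converge. *)
Definition fps_lim (R : zmodType) (u : nat -> fps R) : fps R :=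
  xget 0 [set s | fps_cvg u s]%classic.

Lemma fps_cvg_lim (R : zmodType) (u : nat -> fps R) (s : fps R) :
  fps_cvg u s -> fps_lim u = s.
Proof.
move=> us; rewrite /fps_lim; case: xgetP => [t _ /= ut|/(_ s)//].
apply/fpsP => k; have [M uM] := us k; have [N uN] := ut k.
by rewrite -(uM _ (leq_maxl M N)) (uN _ (leq_maxr M N)).
Qed.

(* Unconditional summation of a family, the coefficients being discrete: s is
   the limit of the finite partial sums along the finite sets of indices. *)
Definition fps_has_sum (R : zmodType) (I : choiceType) (f : I -> fps R)
    (s : fps R) : Prop :=
  forall k, exists J0 : {fset I}, forall J : {fset I}, (J0 `<=` J)%fset ->
    coefs (\sum_(i <- J) f i) k = coefs s k.

Definition qpoch (A : comNzRingType) (a p : A) (m : nat) : A :=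
  \prod_(j < m) (1 - a * p ^+ j).

Definition qpochI (R : comNzRingType) (a p : fps R) : fps R :=
  fps_lim (qpoch a p).

Lemma coefs_exp_lt (R : comNzRingType) (p : fps R) j k :
  coefs p 0 = 0 -> (k < j)%N -> coefs (p ^+ j) k = 0.
Proof.
move=> p0; elim: j k => // j IHj k; rewrite ltnS => kj.
rewrite exprS coefsM big_ord_recl p0 mul0r add0r big1 // => i _.
rewrite IHj ?mulr0 // lift0; have := ltn_ord i.
by case: k kj i => [|k] kj i //= _; rewrite subSS (leq_ltn_trans (leq_subr _ _)).
Qed.

(* The infinite products in powers of a series without constant term converge. *)
Lemma qpochI_cvg (R : comNzRingType) (a p : fps R) :
  coefs p 0 = 0 -> fps_cvg (qpoch a p) (qpochI a p).
Proof.
move=> p0; suff cv : fps_cvg (qpoch a p) (Fps (fun k => coefs (qpoch a p k.+1) k)).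
  by rewrite /qpochI (fps_cvg_lim cv).
move=> k; exists k.+1; elim=> // N IHN; rewrite leq_eqVlt => /orP[/eqP<- //|kN].
rewrite /qpoch big_ord_recr [X in coefs X]/= mulrBr mulr1 mulrA.
rewrite coefsD coefsN [coefs (_ * p ^+ _) k]coefsM [\sum_(i < _) _]big1.
  by rewrite oppr0 addr0 IHN.
move=> i _; rewrite coefs_exp_lt ?mulr0 //.
by rewrite (leq_ltn_trans (leq_subr _ _)).
Qed.

(* Main.v *)
Require Import Defs.
From mathcomp Require Import all_boot all_order all_algebra.
From mathcomp Require Import finmap zify ring.
Import GRing.Theory.
Local Open Scope ring_scope.

(** Put [m = n + r].  The exponent is [2 m^2 + r^2], so with [Q = q^2] the double
    sum is the sum over [m] of [Q^(m^2) beta_m], where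
    [beta_m = 1/(-q;q)_(2m) * sum_r q^(r^2) / ((Q;Q)_(m-r) (q;q^2)_r (q;q)_r)].
    This is the shape of Bailey's lemma.  Call [(alpha, beta)] a Bailey pair in
    base [p] when [beta_n = sum_j alpha_j K_p(n,j)] with the kernel
    [K_p(n,j) = 1/((p;p)_(n-j) (p;p)_(n+j))].  Four identities are combined.

    - [slater_pair]: the sequence [1/((q;q^2)_r (q;q)_r)] belongs to a Bailey
      pair in base [q] whose [alpha] is supported on even indices, with
      [alpha_0 = 1] and [alpha_(2k) = (-1)^k (q^(3k^2-k) + q^(3k^2+k))] for
      [k >= 1].
    - [bailey_base_change]: weighting with [q^(r^2)/(Q;Q)_(m-r)] carries
      [K_q(_,j)] to [(-q;q)_(2m) q^(j^2) K_Q(m,j)].  Hence [beta] belongs to a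
      pair in base [Q] with [alpha] multiplied by [q^(j^2)].
    - [bailey_chain]: weighting with [Q^(m^2)/(Q;Q)_(N-m)] carries [K_Q(_,j)] to
      [Q^(j^2) K_Q(N,j)].
    - [finite_jacobi_triple]: [(a;p)_n (b;p)_n / (p;p)_(2n)] with [p = a b]
      belongs to the pair in base [p] with [alpha_0 = 1] and
      [alpha_k = (-1)^k p^(k(k-1)/2) (a^k + b^k)] for [k >= 1].

    The first three give [double_sum_theta], where the exponents add up at
    [j = 2k] to [3k^2 + 4k^2 + 8k^2 = 15k^2], up to the linear term.  The
    resulting coefficients [(-1)^k (q^(15k^2-k) + q^(15k^2+k))] are those of the
    fourth identity for [a = q^14], [b = q^16].  Letting [N] tend to infinity in
    both, which is done modulo [X^(N+1)], gives the product.

    The second and third identities are cases of one q-Vandermonde sum; that sum,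
    the first and the fourth identity are proved by creative telescoping: a
    recurrence in the length of the sum holds because, term by term, its defect
    is the difference of two consecutive values of an explicit certificate.
    Except in the passage to the limit, everything takes place in a commutative
    ring in which the factors [1 - q^(n+1)] are units. *)

Set Implicit Arguments.
Unset Strict Implicit.

(** * Shifted factorials and their inverses *)

Lemma qpoch0 (A : comNzRingType) (a p : A) : qpoch a p 0 = 1.
Proof. by rewrite /qpoch big_ord0. Qed.

Lemma qpochS (A : comNzRingType) (a p : A) m :
  qpoch a p m.+1 = qpoch a p m * (1 - a * p ^+ m).
Proof. by rewrite /qpoch big_ord_recr. Qed.

Lemma qpochSl (A : comNzRingType) (a p : A) m :
  qpoch a p m.+1 = (1 - a) * qpoch (a * p) p m.
Proof.
rewrite /qpoch big_ord_recl expr0 mulr1; congr (_ * _).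
by apply: eq_bigr => i _; rewrite exprS mulrA.
Qed.

Lemma qpochD (A : comNzRingType) (a p : A) m n :
  qpoch a p (m + n) = qpoch a p m * qpoch (a * p ^+ m) p n.
Proof.
elim: n => [|n IHn]; first by rewrite addn0 qpoch0 mulr1.
by rewrite addnS !qpochS IHn exprD; ring.
Qed.

Lemma qpoch_0l (A : comNzRingType) (p : A) m : qpoch 0 p m = 1.
Proof. by rewrite /qpoch big1 // => i _; rewrite mul0r subr0. Qed.

Lemma qpoch_sqr (A : comNzRingType) (q : A) m :
  qpoch (q ^+ 2) (q ^+ 2) m = qpoch q q m * qpoch (- q) q m.
Proof.
elim: m => [|m IHm]; first by rewrite !qpoch0 mulr1.
by rewrite !qpochS IHm (exprAC q 2 m); ring.
Qed.

Lemma qpoch_unit (A : comUnitRingType) (a p : A) m :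
  (forall j, 1 - a * p ^+ j \is a GRing.unit) -> qpoch a p m \is a GRing.unit.
Proof.
move=> ap; elim: m => [|m IHm]; first by rewrite qpoch0 unitr1.
by rewrite qpochS unitrM IHm ap.
Qed.

Definition qregular (A : comUnitRingType) (q : A) :=
  forall n, 1 - q ^+ n.+1 \is a GRing.unit.

Lemma qregular_exp (A : comUnitRingType) (q : A) d :
  qregular q -> qregular (q ^+ d.+1).
Proof. by move=> hq n; rewrite -exprM mulnS; apply: hq. Qed.

(** The factor [1 + q^(n+1)] divides [1 - q^(2n+2)]. *)
Lemma qregularN (A : comUnitRingType) (q : A) n :
  qregular q -> 1 - - q * q ^+ n \is a GRing.unit.
Proof.
move=> hq; have := hq (2 * n).+1.
have ->: 1 - q ^+ (2 * n).+2 = (1 - q * q ^+ n) * (1 - - q * q ^+ n).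
  by rewrite mul2n -addnn !exprS exprD; ring.
by rewrite unitrM => /andP[].
Qed.

Lemma qpochN_unit (A : comUnitRingType) (q : A) m :
  qregular q -> qpoch (- q) q m \is a GRing.unit.
Proof. by move=> hq; apply: qpoch_unit => j; apply: qregularN. Qed.

Lemma qfact_unit (A : comUnitRingType) (q : A) m :
  qregular q -> qpoch q q m \is a GRing.unit.
Proof. by move=> hq; apply: qpoch_unit => j; rewrite -exprS; apply: hq. Qed.

Definition rfact (A : comUnitRingType) (q : A) n : A := (qpoch q q n)^-1.

Lemma rfact0 (A : comUnitRingType) (q : A) : rfact q 0 = 1.
Proof. by rewrite /rfact qpoch0 invr1. Qed.

Lemma rfactS (A : comUnitRingType) (q : A) n : qregular q ->
  rfact q n = (1 - q ^+ n.+1) * rfact q n.+1.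
Proof.
move=> hq; rewrite /rfact qpochS -exprS invrM ?hq ?qfact_unit //.
by rewrite mulrA divrr ?hq // mul1r.
Qed.

Lemma rfact_sqr (A : comUnitRingType) (q : A) n : qregular q ->
  rfact (q ^+ 2) n * qpoch (- q) q n = rfact q n.
Proof.
move=> hq; rewrite /rfact qpoch_sqr invrM ?qfact_unit ?qpochN_unit //.
by rewrite mulrAC mulVr ?mul1r ?qpochN_unit.
Qed.

(** * The q-Vandermonde sum *)

(** The summand of the q-Chu-Vandermonde sum with the parameter [t] kept in
    polynomial form, so that [t = 0] is allowed: that case is the confluent sum
    behind the Bailey chain, and [t = -q] is the one behind the base change. *)
Definition vdm_term (A : comUnitRingType) (q t : A) M c s : A :=
  q ^+ (s ^ 2 + c * s) * qpoch (t * q ^+ (M - s)) q s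
  * rfact q s * rfact q (M - s) * rfact q (s + c).

Lemma vdm_termS (A : comUnitRingType) (q t : A) M c s :
  qregular q -> (s <= M)%N ->
  (1 - q ^+ s.+1) * (1 - q ^+ (s.+1 + c)) * vdm_term q t M.+1 c s.+1 =
  q ^+ (2 * s + 1 + c) * (1 - t * q ^+ (M - s)) * (1 - q ^+ (M.+1 - s))
  * vdm_term q t M.+1 c s.
Proof.
move=> hq sM; rewrite /vdm_term subSS (subSn sM) qpochSl addSn.
rewrite (rfactS s hq) (rfactS (s + c) hq) (rfactS (M - s) hq).
have -> : (s.+1 ^ 2 + c * s.+1 = (s ^ 2 + c * s) + (2 * s + 1 + c))%N by nia.
by rewrite -[t * _ * q]mulrA -exprSr exprD; ring.
Qed.

(** Lowering [M] by one turns the summand for [t] into the one for [t q], up to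
    the factor [1 - q^(M+1-s)]; the left-hand side collects the defects of the
    recurrence that relates the two sums.  The partial sum on the right carries
    [1 - q^(M+1-S)], hence vanishes at [S = M+1]. *)
Lemma vdm_telescope (A : comUnitRingType) (q t : A) M c S : qregular q ->
  (S <= M.+1)%N ->
  \sum_(s < S.+1)
    ((1 - q ^+ M.+1) * (1 - q ^+ (M.+1 + c)) * vdm_term q t M.+1 c s
     - (1 - t * q ^+ (2 * M + 1 + c)) * (1 - q ^+ (M.+1 - s))
       * vdm_term q t M.+1 c s)
  = - (q ^+ (M.+1 + c) * (q ^+ S - t * q ^+ M) * (1 - q ^+ (M.+1 - S))
       * vdm_term q t M.+1 c S).
Proof.
move=> hq; elim: S => [_|S IHS SM].
  rewrite big_ord1 /= subn0 expr0 mul2n -addnn !exprD expr1 !exprS.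
  ring.
rewrite big_ord_recr /= IHS ?(ltnW SM) //.
rewrite ltnS in SM; have := vdm_termS t c hq SM; rewrite subSS (subSn SM).
move: (vdm_term _ _ _ _ S) (vdm_term _ _ _ _ S.+1) => F G.
rewrite -(subnKC SM); move: (M - S)%N => d; rewrite addKn.
rewrite mul2n -addnn !(exprD, exprS, expr0, mulr1, addSn) => E.
(* The certificate, rewritten as a multiple of the right-hand side of [E]. *)
have -> : - (q * (q ^+ S * q ^+ d) * q ^+ c * (q ^+ S - t * (q ^+ S * q ^+ d))
             * (1 - q * q ^+ d) * F) =
  - q ^+ d * (q ^+ S * q ^+ S * q * q ^+ c * (1 - t * q ^+ d)
              * (1 - q * q ^+ d) * F) by ring.
rewrite -E; ring.
Qed.

(** Both sides satisfy the same first-order recurrence [(M+1, t) -> (M, t q)],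
    which is why the induction is uniform in [t]. *)
Lemma q_vandermonde (A : comUnitRingType) (q t : A) M c : qregular q ->
  \sum_(s < M.+1) vdm_term q t M c s =
  qpoch (t * q ^+ (M + c)) q M * rfact q M * rfact q (M + c).
Proof.
move=> hq; elim: M t => [|M IHM] t.
  by rewrite big_ord1 /vdm_term !(qpoch0, rfact0, muln0, mulr1, mul1r).
have step s : (s <= M)%N ->
    (1 - q ^+ (M.+1 - s)) * vdm_term q t M.+1 c s = vdm_term q (t * q) M c s.
  move=> sM; rewrite /vdm_term (subSn sM) (rfactS (M - s) hq).
  by rewrite [q ^+ (M - s).+1]exprS mulrA; ring.
have := vdm_telescope t c hq (leqnn M.+1).
rewrite subnn subrr mulr0 mul0r oppr0 sumrB -mulr_sumr => /subr0_eq.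
under [in RHS]eq_bigr => s _ do rewrite -mulrA.
rewrite -mulr_sumr [X in _ = _ * X]big_ord_recr /= subnn subrr mul0r addr0.
under [in RHS]eq_bigr => s _ do rewrite step -1?ltnS //.
rewrite IHM => E.
have U : (1 - q ^+ M.+1) * (1 - q ^+ (M.+1 + c)) \is a GRing.unit.
  by rewrite unitrM addSn !hq.
apply: (mulrI U); rewrite E (rfactS M hq) (rfactS (M + c) hq) addSn.
have -> : t * q * q ^+ (M + c) = t * q ^+ (M + c).+1 by rewrite exprS mulrA.
rewrite qpochS -[_ * q ^+ M]mulrA -exprD.
have -> : (2 * M + 1 + c = (M + c).+1 + M)%N by lia.
by ring.
Qed.

(** * Bailey pairs: chain and change of base *)

(** The reciprocal of a factorial with negative index is read as 0, which is what
    makes the two relations below hold without any condition on [j]. *)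
Definition bailey_kernel (A : comUnitRingType) (p : A) n j : A :=
  if (j <= n)%N then rfact p (n - j) * rfact p (n + j) else 0.

Lemma bailey_kernel_shift (A : comUnitRingType) (p : A) n j : qregular p ->
  (1 - p ^+ (n - j)) * bailey_kernel p n j =
  (1 - p ^+ (n + j).+1) * bailey_kernel p n j.+1.
Proof.
move=> hp; rewrite /bailey_kernel; case: ltngtP => [jn|nj|<-].
- rewrite addnS (rfactS (n + j) hp) -(subnSK jn) (rfactS (n - j.+1) hp); ring.
- by rewrite !mulr0.
- by rewrite subnn subrr mul0r mulr0.
Qed.

Lemma bailey_kernel_pred (A : comUnitRingType) (p : A) n j : qregular p ->
  bailey_kernel p n j =
  (1 - p ^+ (n.+1 - j)) * (1 - p ^+ (n.+1 + j)) * bailey_kernel p n.+1 j.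
Proof.
move=> hp; rewrite /bailey_kernel; case: leqP => [jn|nj].
  rewrite (leqW jn) (subSn jn) addSn (rfactS (n - j) hp) (rfactS (n + j) hp).
  by ring.
case: leqP => [jn|_]; last by rewrite mulr0.
have -> : j = n.+1 by lia.
by rewrite subnn subrr !mul0r.
Qed.

(** Substituting [r = j + s] brings a weighted column of the kernel to the form
    of the q-Vandermonde sum with [c = 2j]. *)
Lemma sum_bailey_kernel (A : comUnitRingType) (q : A) (w : nat -> A) m j :
  (j <= m)%N ->
  \sum_(r < m.+1) w r * bailey_kernel q r j =
  \sum_(s < (m - j).+1) w (j + s)%N * rfact q s * rfact q (s + 2 * j).
Proof.
move=> jm; rewrite -(big_mkord xpredT (fun r => w r * bailey_kernel q r j)).
rewrite (big_cat_nat _ (n := j)) ?(leqW jm) //=.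
rewrite big_nat_cond big1 ?add0r; last first.
  by move=> r /andP[/andP[_ rj] _]; rewrite /bailey_kernel leqNgt rj mulr0.
rewrite -{1}[j]add0n big_addn big_mkord subSn //.
apply: eq_bigr => s _; rewrite /bailey_kernel leq_addl addnK addnC mulrA.
by congr (_ * rfact q _); lia.
Qed.

(** The q-Vandermonde sum at [t = 0]: Bailey's lemma with both parameters sent to
    infinity. *)
Lemma bailey_chain (A : comUnitRingType) (q : A) N j : qregular q ->
  \sum_(m < N.+1) q ^+ (m ^ 2) * rfact q (N - m) * bailey_kernel q m j =
  q ^+ (j ^ 2) * bailey_kernel q N j.
Proof.
move=> hq; case: (leqP j N) => jN; last first.
  rewrite /bailey_kernel leqNgt jN mulr0 big1 // => m _.
  by rewrite leqNgt (leq_ltn_trans _ jN) ?mulr0 // -ltnS.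
rewrite (sum_bailey_kernel q (fun m => q ^+ (m ^ 2) * rfact q (N - m)) jN).
have := q_vandermonde 0 (N - j) (2 * j) hq.
rewrite mul0r qpoch_0l mul1r /bailey_kernel jN.
have -> : (N - j + 2 * j = N + j)%N by lia.
move=> <-; rewrite mulr_sumr; apply: eq_bigr => s _.
rewrite /vdm_term mul0r qpoch_0l mulr1 subnDA.
have -> : ((j + s) ^ 2 = j ^ 2 + (s ^ 2 + 2 * j * s))%N by nia.
by rewrite exprD; ring.
Qed.

(** The q-Vandermonde sum at [t = -q]: since [(Q;Q)_n = (q;q)_n (-q;q)_n] for
    [Q = q^2], the weight [1/(Q;Q)_(m-r)] splits into [1/(q;q)_(m-r)] and a factor
    that the term [(t q^(M-s);q)_s] completes to [1/(-q;q)_(m-j)]. *)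
Lemma bailey_base_change (A : comUnitRingType) (q : A) m j : qregular q ->
  \sum_(r < m.+1) q ^+ (r ^ 2) * rfact (q ^+ 2) (m - r) * bailey_kernel q r j =
  qpoch (- q) q (2 * m) * q ^+ (j ^ 2) * bailey_kernel (q ^+ 2) m j.
Proof.
move=> hq; case: (leqP j m) => jm; last first.
  rewrite /bailey_kernel leqNgt jm mulr0 big1 // => r _.
  by rewrite leqNgt (leq_ltn_trans _ jm) ?mulr0 // -ltnS.
rewrite (sum_bailey_kernel q (fun r => q ^+ (r ^ 2) * rfact (q ^+ 2) (m - r)) jm).
have := q_vandermonde (- q) (m - j) (2 * j) hq.
rewrite -(rfact_sqr (m - j) hq) -(rfact_sqr (m - j + 2 * j) hq).
rewrite /bailey_kernel jm.
have -> : (m - j + 2 * j = m + j)%N by lia.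
have -> : (2 * m = (m + j) + (m - j))%N by lia.
rewrite (qpochD _ _ (m + j) (m - j)) => E.
apply: (mulrI (qpochN_unit (m - j) hq)).
transitivity (q ^+ (j ^ 2) * (qpoch (- q * q ^+ (m + j)) q (m - j) *
    (rfact (q ^+ 2) (m - j) * qpoch (- q) q (m - j)) *
    (rfact (q ^+ 2) (m + j) * qpoch (- q) q (m + j)))); last by ring.
rewrite -E !mulr_sumr; apply: eq_bigr => s _.
rewrite /vdm_term subnDA.
have sm : (s <= m - j)%N by rewrite -ltnS.
rewrite -{1}(subnK sm) (qpochD _ _ (m - j - s) s) -(rfact_sqr (m - j - s) hq).
have -> : ((j + s) ^ 2 = j ^ 2 + (s ^ 2 + 2 * j * s))%N by nia.
by rewrite exprD; ring.
Qed.

(** * Two Bailey pairs with theta coefficients *)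

(** The coefficients of the one-sided theta series
    [1 + sum_(k >= 1) (-1)^k (ab)^(k(k-1)/2) (a^k + b^k)], in which the indices [k]
    and [-k] of the Jacobi triple product are folded together. *)
Definition theta_coef (A : comUnitRingType) (a b : A) k : A :=
  if k is 0 then 1 else (-1) ^+ k * (a * b) ^+ 'C(k, 2) * (a ^+ k + b ^+ k).

Lemma bailey_kernel00 (A : comUnitRingType) (p : A) : bailey_kernel p 0 0 = 1.
Proof. by rewrite /bailey_kernel /= !rfact0 mulr1. Qed.

Lemma bailey_kernel_out (A : comUnitRingType) (p : A) n j :
  (n < j)%N -> bailey_kernel p n j = 0.
Proof. by rewrite ltnNge /bailey_kernel => /negbTE->. Qed.

(** Certificate for the recurrence
    [(1 - q^(2r+1)) (1 - q^(r+1)) V_(r+1) = V_r] satisfied by the sums [V_r] of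
    [slater_pair].  The certificate has this simple form for the coefficients in
    which [k] and [-k] are folded together, not for the bilateral summand
    [(-1)^k q^(3k^2-k) K_q(r,2k)]. *)
Lemma slater_telescope (A : comUnitRingType) (q : A) r K : qregular q ->
  \sum_(k < K.+1) theta_coef (q ^+ 2) (q ^+ 4) k *
    ((1 - q ^+ (r + r).+1) * (1 - q ^+ r.+1) * bailey_kernel q r.+1 (2 * k)
     - bailey_kernel q r (2 * k)) =
  (-1) ^+ K * (q ^+ 6) ^+ 'C(K.+1, 2) * q ^+ r.+1 *
  ((1 - q ^+ (r.+1 - 2 * K)) * (1 - q ^+ (r.+1 - (2 * K).+1))
   * bailey_kernel q r.+1 (2 * K)).
Proof.
move=> hq; elim: K => [|K IHK].
  rewrite big_ord1 muln0 (bailey_kernel_pred r 0 hq) subn0 subSS subn0 addn0.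
  by rewrite bin_small //= !exprS exprD ?subn0 expr0; ring.
have shift : (1 - q ^+ (r.+1 - 2 * K)) * (1 - q ^+ (r.+1 - (2 * K).+1))
     * bailey_kernel q r.+1 (2 * K)
   = (1 - q ^+ (r.+1 + 2 * K).+1) * (1 - q ^+ (r.+1 + 2 * K).+2)
     * bailey_kernel q r.+1 (2 * K.+1).
  rewrite mulrAC (bailey_kernel_shift _ _ hq) mulrAC -mulrA.
  by rewrite (bailey_kernel_shift _ _ hq) mulrA addnS mulnS.
rewrite big_ord_recr /= IHK shift (bailey_kernel_pred r _ hq).
case: (leqP (2 * K.+1) r.+1) => Kr; last first.
  by rewrite bailey_kernel_out // !(mulr0, subrr, addr0).
move: (bailey_kernel _ _ _) => U.
rewrite [in RHS]binS bin1 subnS.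
have [d Er] : exists d, r = ((K + K).+1 + d)%N by exists (r - (K + K).+1)%N; lia.
have -> : (r.+1 - 2 * K.+1 = d)%N by lia.
rewrite Er mul2n -addnn.
by case: d {Er Kr} => [|d] /=;
  rewrite !(addnS, addSn, addn0) !(exprD, exprS, expr0, mulr1, exprMn);
  move: (q ^+ 'C(_, 2)) => z; ring.
Qed.

(** Certificate for the recurrence in [n] satisfied by the sums of
    [finite_jacobi_triple]. *)
Lemma jtp_telescope (A : comUnitRingType) (a b : A) n K : qregular (a * b) ->
  let p := a * b in
  \sum_(k < K.+1) theta_coef a b k *
    ((1 - p ^+ (n + n).+2) * (1 - p ^+ (n + n).+1) * bailey_kernel p n.+1 k
     - (1 - a * p ^+ n) * (1 - b * p ^+ n) * bailey_kernel p n k) =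
  (-1) ^+ K * p ^+ 'C(K, 2)
  * (p ^+ n * (a ^+ K * (a + p ^+ K.+1) + b ^+ K * (b + p ^+ K.+1))
     - p ^+ (n + n).+1 * (a ^+ K * (1 + p ^+ K * a) + b ^+ K * (1 + p ^+ K * b)))
  * ((1 - p ^+ (n.+1 - K)) * bailey_kernel p n.+1 K).
Proof.
move=> hp p; elim: K => [|K IHK].
  rewrite big_ord1 (bailey_kernel_pred n 0 hp) subn0 addn0 bin_small //=.
  rewrite -/p !exprS exprD expr0.
  by move: (p ^+ n) (bailey_kernel _ _ _) => x U; rewrite /p; ring.
rewrite big_ord_recr /= IHK.
rewrite (bailey_kernel_shift _ _ hp) (bailey_kernel_pred n _ hp) -/p.
case: (leqP K n) => Kn; last first.
  by rewrite bailey_kernel_out // !(mulr0, subrr, addr0).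
rewrite binS bin1 subSS -(subnKC Kn) addKn -/p.
move: (n - K)%N (bailey_kernel _ _ _) => d U.
rewrite !(addnS, addSn) !(exprD, exprS).
move: (p ^+ 'C(K, 2)) (p ^+ K) (p ^+ d) (a ^+ K) (b ^+ K) => z y x aK bK.
move: ((-1) ^+ K) => e.
rewrite /p; ring.
Qed.

Lemma sum_bailey_kernel_row0 (A : comUnitRingType) (a b p : A)
    (f : nat -> nat) K :
  f 0 = 0%N -> (forall k, 0 < f k.+1)%N ->
  \sum_(k < K.+1) theta_coef a b k * bailey_kernel p 0 (f k) = 1.
Proof.
move=> f0 fS; rewrite big_ord_recl f0 bailey_kernel00 mulr1.
rewrite big1 ?addr0 // => k _.
by rewrite bailey_kernel_out ?mulr0 // lift0.
Qed.

Lemma qpoch_odd_unit (A : comUnitRingType) (q : A) r : qregular q ->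
  qpoch q (q ^+ 2) r \is a GRing.unit.
Proof. by move=> hq; apply: qpoch_unit => j; rewrite -exprM -exprS; apply: hq. Qed.

(** The certificate vanishes once [K] exceeds [r], so the sum satisfies the
    recurrence of the right-hand side; the bound [K] may be any number [>= r]
    because the kernel is 0 beyond, and a common bound is needed to exchange
    summations. *)
Lemma slater_pair (A : comUnitRingType) (q : A) r K :
  qregular q -> (r <= K)%N ->
  \sum_(k < K.+1) theta_coef (q ^+ 2) (q ^+ 4) k * bailey_kernel q r (2 * k) =
  (qpoch q (q ^+ 2) r * qpoch q q r)^-1.
Proof.
move=> hq; elim: r => [_|r IHr rK].
  by rewrite (sum_bailey_kernel_row0 _ _ _ (f := muln 2)) // !qpoch0 mulr1 invr1.
have := slater_telescope r K hq.
have -> : (1 - q ^+ (r.+1 - 2 * K)) * (1 - q ^+ (r.+1 - (2 * K).+1)) *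
    bailey_kernel q r.+1 (2 * K) = 0.
  have [lt|ge] := ltnP r.+1 (2 * K); first by rewrite bailey_kernel_out ?mulr0.
  by have -> : (r.+1 - (2 * K).+1 = 0)%N by [lia]; rewrite subrr mulr0 mul0r.
rewrite mulr0; under eq_bigr => k _ do rewrite mulrBr mulrCA.
rewrite sumrB -mulr_sumr IHr 1?ltnW // => /subr0_eq E.
have U1 : 1 - q ^+ (r + r).+1 \is a GRing.unit by apply: hq.
have U2 : 1 - q ^+ r.+1 \is a GRing.unit by apply: hq.
have U : (1 - q ^+ (r + r).+1) * (1 - q ^+ r.+1) \is a GRing.unit.
  by rewrite unitrM U1.
apply: (mulrI U); rewrite E !qpochS -exprS.
have -> : q * (q ^+ 2) ^+ r = q ^+ (r + r).+1.
  by rewrite -exprM mul2n -addnn exprS.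
have V : qpoch q (q ^+ 2) r * qpoch q q r \is a GRing.unit.
  by rewrite unitrM qpoch_odd_unit ?qfact_unit.
by rewrite mulrACA (invrM V U) mulVKr.
Qed.

(** The Jacobi triple product before the passage to the limit, divided by
    [(ab;ab)_(2n)] so as to read as a Bailey pair. *)
Lemma finite_jacobi_triple (A : comUnitRingType) (a b : A) n K :
  qregular (a * b) -> (n <= K)%N ->
  \sum_(k < K.+1) theta_coef a b k * bailey_kernel (a * b) n k =
  qpoch a (a * b) n * qpoch b (a * b) n * rfact (a * b) (n + n).
Proof.
move=> hp; elim: n => [_|n IHn nK].
  by rewrite (sum_bailey_kernel_row0 _ _ _ (f := id)) // !qpoch0 rfact0 !mulr1.
have := jtp_telescope n K hp; rewrite /=.
have -> : (1 - (a * b) ^+ (n.+1 - K)) * bailey_kernel (a * b) n.+1 K = 0.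
  have [lt|ge] := ltnP n.+1 K; first by rewrite bailey_kernel_out ?mulr0.
  by have -> : (n.+1 - K = 0)%N by [lia]; rewrite subrr mul0r.
rewrite mulr0; under eq_bigr => k _ do
  rewrite mulrBr mulrCA [theta_coef _ _ _ * (_ * _ * bailey_kernel _ n _)]mulrCA.
rewrite sumrB -!mulr_sumr IHn 1?ltnW // => /subr0_eq E.
have U : (1 - (a * b) ^+ (n + n).+2) * (1 - (a * b) ^+ (n + n).+1)
    \is a GRing.unit.
  by rewrite unitrM !hp.
apply: (mulrI U); rewrite E !qpochS addnS addSn.
by rewrite (rfactS (n + n) hp) (rfactS (n + n).+1 hp); ring.
Qed.

(** This identifies [q^(12k^2)] times the coefficients of [slater_pair] with the
    theta coefficients for [q^14] and [q^16]. *)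
Lemma theta_coef_scale (A : comUnitRingType) (a b t : A) k :
  theta_coef (a * t) (b * t) k = theta_coef a b k * t ^+ (k ^ 2).
Proof.
case: k => [|k]; first by rewrite mulr1.
have -> : (k.+1 ^ 2 = 'C(k.+1, 2) + 'C(k.+1, 2) + k.+1)%N.
  by elim: k => // k IHk; rewrite binS bin1; nia.
rewrite /theta_coef !exprMn !exprD; ring.
Qed.

(** * The double sum at a finite level *)

(** The contribution of [n + r = m] to the double sum, without the factor
    [q^(2m^2)]. *)
Definition inner_sum (A : comUnitRingType) (q : A) m : A :=
  (qpoch (- q) q (2 * m))^-1 *
  \sum_(r < m.+1) q ^+ (r ^ 2) * rfact (q ^+ 2) (m - r)
    * (qpoch q (q ^+ 2) r * qpoch q q r)^-1.

Lemma double_sum_theta (A : comUnitRingType) (q : A) N : qregular q ->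
  \sum_(m < N.+1) (q ^+ 2) ^+ (m ^ 2) * rfact (q ^+ 2) (N - m) * inner_sum q m =
  \sum_(k < N.+1) theta_coef (q ^+ 14) (q ^+ 16) k
    * bailey_kernel (q ^+ 2) N (2 * k).
Proof.
move=> hq; pose c k := theta_coef (q ^+ 2) (q ^+ 4) k.
have inner m : (m <= N)%N ->
    inner_sum q m =
    \sum_(k < N.+1) c k * q ^+ ((2 * k) ^ 2) * bailey_kernel (q ^+ 2) m (2 * k).
  move=> mN; rewrite /inner_sum; under eq_bigr => r _ do
    rewrite -(slater_pair hq (leq_trans (leq_ord r) mN)) mulr_sumr.
  rewrite exchange_big /= mulr_sumr; apply: eq_bigr => k _.
  under eq_bigr => r _ do rewrite mulrCA.
  rewrite -mulr_sumr (bailey_base_change _ _ hq) !mulrA [_^-1 * _]mulrC -!mulrA.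
  by rewrite mulKr ?qpochN_unit.
under eq_bigr => m _ do rewrite inner ?leq_ord // mulr_sumr.
rewrite exchange_big /=; apply: eq_bigr => k _.
under eq_bigr => m _ do rewrite mulrCA.
rewrite -mulr_sumr (bailey_chain _ _ (qregular_exp 1 hq)) mulrA; congr (_ * _).
have -> : q ^+ 14 = q ^+ 2 * q ^+ 12 by rewrite -exprD.
have -> : q ^+ 16 = q ^+ 4 * q ^+ 12 by rewrite -exprD.
rewrite theta_coef_scale -mulrA -!exprM -exprD; congr (_ * q ^+ _); nia.
Qed.

Lemma summand_split (A : comUnitRingType) (q : A) n r : qregular q ->
  q ^+ (2 * n ^ 2 + 3 * r ^ 2 + 4 * n * r)
  / (qpoch (- q) q (2 * n + 2 * r) * qpoch q (q ^+ 2) r * qpoch q q r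
     * qpoch (q ^+ 2) (q ^+ 2) n) =
  (q ^+ 2) ^+ ((n + r) ^ 2) * ((qpoch (- q) q (2 * (n + r)))^-1 *
    (q ^+ (r ^ 2) * rfact (q ^+ 2) n * (qpoch q (q ^+ 2) r * qpoch q q r)^-1)).
Proof.
move=> hq; have U := qpochN_unit (2 * (n + r)) hq.
have V := qpoch_odd_unit r hq; have W := qfact_unit r hq.
have Z := qfact_unit n (qregular_exp 1 hq).
have -> : (2 * n ^ 2 + 3 * r ^ 2 + 4 * n * r = 2 * (n + r) ^ 2 + r ^ 2)%N by nia.
rewrite -mulnDr exprD exprM /rfact.
rewrite (invrM _ Z) ?(invrM _ W) ?(invrM U V) ?(invrM V W) ?unitrM ?U ?V ?W //.
by ring.
Qed.

(** * Power series modulo a power of the variable *)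

Definition eqmodX (R : zmodType) n (f g : fps R) :=
  forall k, (k < n)%N -> coefs f k = coefs g k.

Lemma eqmodX_sym (R : zmodType) n (f g : fps R) : eqmodX n f g -> eqmodX n g f.
Proof. by move=> fg k kn; rewrite fg. Qed.

Lemma eqmodX_trans (R : zmodType) n (f g h : fps R) :
  eqmodX n f g -> eqmodX n g h -> eqmodX n f h.
Proof. by move=> fg gh k kn; rewrite fg ?gh. Qed.

Lemma eqmodXW (R : zmodType) m n (f g : fps R) :
  (m <= n)%N -> eqmodX n f g -> eqmodX m f g.
Proof. by move=> mn fg k km; apply: fg; apply: leq_trans mn. Qed.

Lemma coefs_sum (R : zmodType) (I : Type) (s : seq I) (P : pred I)
    (F : I -> fps R) k :
  coefs (\sum_(i <- s | P i) F i) k = \sum_(i <- s | P i) coefs (F i) k.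
Proof. by elim/big_rec2: _ => // i _ f _ <-. Qed.

Lemma eqmodX_sum (R : zmodType) n (I : Type) (s : seq I) (F G : I -> fps R) :
  (forall i, eqmodX n (F i) (G i)) ->
  eqmodX n (\sum_(i <- s) F i) (\sum_(i <- s) G i).
Proof. by move=> FG k kn; rewrite !coefs_sum; apply: eq_bigr => i _; apply: FG. Qed.

(** Precision gained from a factor divisible by [X^m]: this is what compensates
    the low precision of [(p;p)_(N-j)] as an approximation of [(p;p)_oo]. *)
Lemma eqmodX_shift (R : comNzRingType) m n (d f g : fps R) :
  eqmodX m d 0 -> eqmodX n f g -> eqmodX (m + n) (d * f) (d * g).
Proof.
move=> d0 fg k kmn; rewrite !coefsM; apply: eq_bigr => i _.
have [im|mi] := ltnP i m; first by rewrite d0 // !mul0r.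
by rewrite fg //; have := ltn_ord i; lia.
Qed.

Lemma eqmodXM (R : comNzRingType) n (f f' g g' : fps R) :
  eqmodX n f f' -> eqmodX n g g' -> eqmodX n (f * g) (f' * g').
Proof.
move=> ff' gg'; apply: (@eqmodX_trans _ _ _ (f * g')).
  exact: (@eqmodX_shift _ 0).
by rewrite ![_ * g']mulrC; apply: (@eqmodX_shift _ 0).
Qed.

Lemma eqmodX_exp (R : comNzRingType) (p : fps R) e h :
  coefs p 0 = 0 -> eqmodX e (p ^+ e * h) 0.
Proof.
move=> p0; rewrite -(addn0 e) -(mulr0 (p ^+ (e + 0))); apply: eqmodX_shift => //.
by move=> k ke; rewrite coefs_exp_lt // addn0.
Qed.

Lemma fps_qregular (R : comUnitRingType) (p : fps R) :
  coefs p 0 = 0 -> qregular p.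
Proof.
move=> p0 n; change (coefs (1 - p ^+ n.+1) 0 \is a GRing.unit).
by rewrite coefsD coefsN coefs_exp_lt // subr0 unitr1.
Qed.

(** A product truncated after [n] factors is correct up to [X^n], one order more
    than the powers of [p] give, because [a] has no constant term. *)
Lemma eqmodX_qpochI (R : comNzRingType) (a p : fps R) n :
  coefs a 0 = 0 -> coefs p 0 = 0 -> eqmodX n.+1 (qpochI a p) (qpoch a p n).
Proof.
move=> a0 p0.
have stable d : eqmodX n.+1 (qpoch a p (n + d)) (qpoch a p n).
  elim: d => [|d IHd]; first by rewrite addn0.
  apply: eqmodX_trans IHd; rewrite addnS qpochS -[X in eqmodX _ _ X]mulr1.
  apply: eqmodXM => // k kn; rewrite coefsD coefsN.
  have -> : coefs (a * p ^+ (n + d)) k = 0; last by rewrite oppr0 addr0.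
  rewrite -(expr1 a) mulrC -[a ^+ 1]mulr1.
  have X0 : eqmodX (n + d + 1) (p ^+ (n + d) * (a ^+ 1 * 1)) (p ^+ (n + d) * 0).
    apply: eqmodX_shift; last exact: eqmodX_exp.
    by rewrite -[p ^+ _]mulr1; apply: eqmodX_exp.
  by rewrite X0 ?mulr0 //; lia.
move=> k kn; have [N0 HN0] := qpochI_cvg a p0 k.
by rewrite -(HN0 (n + N0)%N) ?leq_addl // stable.
Qed.

Lemma eqmodX_rfact (R : comUnitRingType) (p : fps R) n :
  coefs p 0 = 0 -> eqmodX n.+1 (qpochI p p * rfact p n) 1.
Proof.
move=> p0; rewrite -(divrr (qfact_unit n (fps_qregular p0))).
by apply: eqmodXM => //; apply: eqmodX_qpochI.
Qed.

Lemma qpochI_unit (R : comUnitRingType) (a p : fps R) :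
  coefs a 0 = 0 -> coefs p 0 = 0 -> qpochI a p \is a GRing.unit.
Proof.
move=> a0 p0; change (coefs (qpochI a p) 0 \is a GRing.unit).
by rewrite (eqmodX_qpochI (n := 0) a0 p0) // qpoch0 unitr1.
Qed.

(** The kernel tends to [1/(p;p)_oo^2] in each column.  Column [f k] is known only
    modulo [X^(N - f k + 1)], which suffices as soon as [X^(f k)] divides its
    coefficient; the columns beyond [N] are negligible for the same reason. *)
Lemma bailey_sum_limit (R : comUnitRingType) (p : fps R) (f : nat -> nat)
    (d : nat -> fps R) N :
  coefs p 0 = 0 -> (forall k, eqmodX (f k) (d k) 0) ->
  eqmodX N.+1
    (qpochI p p ^+ 2 * \sum_(k < N.+1) d k * bailey_kernel p N (f k))
    (\sum_(k < N.+1) d k).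
Proof.
move=> p0 d0; rewrite mulr_sumr; apply: eqmodX_sum => k.
rewrite mulrCA -[X in eqmodX _ _ X]mulr1 /bailey_kernel.
case: leqP => [fN|Nf]; last first.
  apply: (@eqmodXW _ _ (f k + 0)); first by rewrite addn0.
  exact: eqmodX_shift.
apply: (@eqmodXW _ _ (f k + (N - f k).+1)); first by lia.
apply: eqmodX_shift => //; rewrite expr2 mulrACA -[X in eqmodX _ _ X]mulr1.
apply: eqmodXM; first exact: eqmodX_rfact.
apply: (@eqmodXW _ _ (N + f k).+1); first by lia.
exact: eqmodX_rfact.
Qed.

Lemma theta_coef_val (R : comUnitRingType) (q : fps R) c d e k :
  coefs q 0 = 0 -> (c <= d)%N -> (c <= e)%N ->
  eqmodX (c * k) (theta_coef (q ^+ d) (q ^+ e) k) 0.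
Proof.
move=> q0 cd ce; case: k => [|k]; first by rewrite muln0.
have E : (q ^+ d) ^+ k.+1 + (q ^+ e) ^+ k.+1 =
    q ^+ (c * k.+1) * ((q ^+ (d - c)) ^+ k.+1 + (q ^+ (e - c)) ^+ k.+1).
  by rewrite mulrDr exprM -!exprMn -!exprD !subnKC.
by rewrite /theta_coef E mulrCA; apply: eqmodX_exp.
Qed.

(** Jacobi's triple product identity, truncated. *)
Lemma theta_jacobi_limit (R : comUnitRingType) (a b p : fps R) N :
  p = a * b -> coefs a 0 = 0 -> coefs b 0 = 0 ->
  (forall k, eqmodX k (theta_coef a b k) 0) ->
  eqmodX N.+1 (\sum_(k < N.+1) theta_coef a b k)
    (qpochI a p * qpochI b p * qpochI p p).
Proof.
move=> pE a0 b0 v.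
have p0 : coefs p 0 = 0 by rewrite pE coefsM big_ord1 a0 mul0r.
apply: (eqmodX_trans (eqmodX_sym (bailey_sum_limit (N := N) (f := id) p0 v))).
have := finite_jacobi_triple (a := a) (b := b) (n := N) (K := N).
rewrite -pE => -> //; last exact: fps_qregular.
have regroup (u x y z : fps R) : u ^+ 2 * (x * y * z) = x * y * u * (u * z).
  by rewrite expr2 mulrCA !mulrA.
rewrite [X in eqmodX _ X _]regroup.
rewrite -[X in eqmodX _ _ X]mulr1; apply: eqmodXM.
  apply: eqmodXM; [apply: eqmodXM|]; apply/eqmodX_sym => //;
    exact: eqmodX_qpochI.
apply: (@eqmodXW _ _ (N + N).+1); first by rewrite ltnS leq_addr.
exact: eqmodX_rfact.
Qed.

(** Multiplying [double_sum_theta] by [(Q;Q)_oo^2], one factor cancels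
    [(Q;Q)_(N-m)] on the left, where the error is absorbed by [Q^(m^2)], and both
    cancel the kernel on the right. *)
Lemma double_sum_limit (R : comUnitRingType) (q : fps R) N : coefs q 0 = 0 ->
  eqmodX N.+1 (\sum_(m < N.+1) (q ^+ 2) ^+ (m ^ 2) * inner_sum q m)
    (qpochI (q ^+ 14) (q ^+ 30) * qpochI (q ^+ 16) (q ^+ 30)
       * qpochI (q ^+ 30) (q ^+ 30) / qpochI (q ^+ 2) (q ^+ 2)).
Proof.
move=> q0; set Q := q ^+ 2; set P := qpochI Q Q.
have X0 e : coefs (q ^+ e.+1) 0 = 0 by rewrite coefs_exp_lt.
have v k : eqmodX k (theta_coef (q ^+ 14) (q ^+ 16) k) 0.
  rewrite -[X in eqmodX X](mul1n k); exact: (@theta_coef_val R q 1 14 16 k q0).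
have PU : P \is a GRing.unit by apply: qpochI_unit; apply: X0.
have J := theta_jacobi_limit (N := N) (exprD q 14 16) (X0 13) (X0 15) v.
have v2 k : eqmodX (2 * k) (theta_coef (q ^+ 14) (q ^+ 16) k) 0.
  exact: theta_coef_val.
have B := bailey_sum_limit (N := N) (X0 1) v2.
rewrite -(double_sum_theta N (fps_qregular q0)) -/Q -/P expr2 -mulrA in B.
have S : eqmodX N.+1
    (P * \sum_(m < N.+1) Q ^+ (m ^ 2) * rfact Q (N - m) * inner_sum q m)
    (\sum_(m < N.+1) Q ^+ (m ^ 2) * inner_sum q m).
  rewrite mulr_sumr; apply: eqmodX_sum => m; rewrite mulrA.
  apply: eqmodXM => //; rewrite mulrCA -[X in eqmodX _ _ X]mulr1.
  have mN : (m <= N)%N by rewrite -ltnS.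
  apply: (@eqmodXW _ _ (m ^ 2 + (N - m).+1)); first by nia.
  apply: eqmodX_shift; last by apply: eqmodX_rfact; apply: X0.
  by rewrite -[Q ^+ _]mulr1; apply: eqmodX_exp; apply: X0.
rewrite -[X in eqmodX _ X _](mulKr PU) [X in eqmodX _ _ X]mulrC.
apply: eqmodXM => //; apply: eqmodX_trans J; apply: eqmodX_trans B.
by apply: eqmodXM => //; apply: eqmodX_sym.
Qed.

(** If [X^(n+r)] divides the term of index [(n,r)], the coefficient of [X^k] of
    any finite sum containing the pairs with [n + r <= k] is already final. *)
Lemma antidiagonal_has_sum (R : zmodType) (f : nat * nat -> fps R) (s : fps R) :
  (forall x, eqmodX (x.1 + x.2) (f x) 0) ->
  (forall N, eqmodX N.+1
    (\sum_(m < N.+1) \sum_(r < m.+1) f ((m - r)%N, nat_of_ord r)) s) ->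
  fps_has_sum f s.
Proof.
move=> f0 fs k.
pose l := [seq ((m - r)%N, r) | m <- iota 0 k.+1, r <- iota 0 m.+1].
have l_mem x : (x \in l) = (x.1 + x.2 <= k)%N.
  apply/allpairsPdep/idP => [[m [r]]|xk].
    by rewrite !mem_iota /= !add0n !ltnS => -[mk rm ->] /=; rewrite subnK.
  exists (x.1 + x.2)%N, x.2; rewrite !mem_iota /= !add0n !ltnS addnK leq_addl.
  by split=> //; case: (x).
have l_uniq : uniq l.
  apply: allpairs_uniq_dep => [|m _|]; try exact: iota_uniq.
  move=> _ _ /allpairsPdep[m [r [_ rm ->]]] /allpairsPdep[m' [r' [_ rm' ->]]] /=.
  move: rm rm'; rewrite !mem_iota /= !add0n !ltnS => rm rm' [E rr'].
  by rewrite -(subnK rm) -(subnK rm') E rr'.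
exists [fset x in l]%fset => J lJ.
rewrite -(fs k k) // [in RHS]coefs_sum coefs_sum.
rewrite -(big_fset_incl _ lJ) => [|x _]; last first.
  rewrite in_fset l_mem -ltnNge => kx; exact: f0.
rewrite (perm_big l) /=; last first.
  by apply: uniq_perm l_uniq _ => [|x]; rewrite ?fset_uniq ?in_fset.
rewrite big_allpairs_dep -[k.+1]subn0 -/(index_iota 0 k.+1) big_mkord.
apply: eq_bigr => m _; rewrite coefs_sum -[m.+1]subn0.
by rewrite -/(index_iota 0 m.+1) big_mkord.
Qed.

(** * The theorem *)

Unset Implicit Arguments.

Theorem mainTheorem4 (R : comUnitRingType) :
  let q : fps R := fpsX R in
  fps_has_sum
    (fun nr : nat * nat =>
       let: (n, r) := nr in
       q ^+ (2 * n ^ 2 + 3 * r ^ 2 + 4 * n * r)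
       / (qpoch (- q) q (2 * n + 2 * r) * qpoch q (q ^+ 2) r * qpoch q q r
          * qpoch (q ^+ 2) (q ^+ 2) n))
    (qpochI (q ^+ 14) (q ^+ 30) * qpochI (q ^+ 16) (q ^+ 30)
       * qpochI (q ^+ 30) (q ^+ 30)
     / qpochI (q ^+ 2) (q ^+ 2)).
Proof.
move=> q; have q0 : coefs q 0 = 0 by [].
have hq := fps_qregular q0.
apply: antidiagonal_has_sum => [[n r]|N] /=.
  have -> : (2 * n ^ 2 + 3 * r ^ 2 + 4 * n * r =
             (n + r) + (2 * n ^ 2 - n + (3 * r ^ 2 - r) + 4 * n * r))%N by nia.
  by rewrite exprD -mulrA; apply: eqmodX_exp.
rewrite (_ : \sum_(_ < _) _ =
             \sum_(m < N.+1) (q ^+ 2) ^+ (m ^ 2) * inner_sum q m).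
  exact: double_sum_limit.
apply: eq_bigr => m _; rewrite /inner_sum !mulr_sumr; apply: eq_bigr => r _.
by rewrite summand_split // subnK // -ltnS.
Qed.
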